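(* For every $n>0$, the matrix $H_n$ is diagonalizable with eigenvalues $s!$, $s\in\{0,\ldots,n+1\}$ (counted with multiplicity, so that $1=0!=1!$ has multiplicity two). Moreover, $H_n$ commutes with $\rho_n$; for every $s\in\{2,\ldots,n+1\}$ the restriction of $\rho_n$ to the eigenspace of $H_n$ associated to $s!$ is $(-1)^{n+1-s}\,\mathrm{id}$, and the two-dimensional eigenspace associated to $1=0!=1!$ is the direct sum of two lines on which $\rho_n$ acts as $(-1)^{n+1}\,\mathrm{id}$ and $(-1)^n\,\mathrm{id}$ respectively.
   Context: For $n>0$ and $s\in\{0,\ldots,n+1\}$, $T_s^n=\Delta_n\setminus(\sigma_1\cup\cdots\cup\sigma_s)$ is the standard closed $n$-simplex deprived of $s$ of its (closed) facets, and $\mathrm{Sd}(T_s^n)=\mathrm{Sd}(\Delta_n)\setminus\bigcup_{i=1}^s\mathrm{Sd}(\sigma_i)$, with $\mathrm{Sd}$ the barycentric subdivision. A tiling of $\mathrm{Sd}(T_s^n)$ is a partition of it into disjoint tiles, each being an $n$-simplex of $\mathrm{Sd}(\Delta_n)$ deprived of $t$ of its facets for some $t\in\{0,\ldots,n+1\}$ (a tile of type $T_t^n$); its $h$-vector is $(h_0,\ldots,h_{n+1})$, where $h_t$ is the number of tiles of type $T_t^n$. $H_n$ is the $(n+2)\times(n+2)$ matrix whose $(s+1)$-st row, $s\in\{0,\ldots,n+1\}$, is the $h$-vector of a tiling of $\mathrm{Sd}(T_s^n)$ which contains exactly one tile $T_0^n$ if $s=0$ and no tile $T_0^n$ if $s>0$;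 such tilings exist and their $h$-vector does not depend on the choice. Equivalently, $H_n$ is given recursively by $H_0=\mathrm{Id}_2$ and: for $n\geq 0$ and $s\in\{1,\ldots,n+3\}$, the $s$-th row of $H_{n+1}$ is the sum of the first $s-1$ rows of $H_n$ shifted by one step to the right (i.e. preceded by a $0$) and of the last $n+3-s$ rows of $H_n$ (followed by a $0$). For instance $H_1=\begin{pmatrix}1&1&0\\0&2&0\\0&1&1\end{pmatrix}$. $H_n$ is viewed as an endomorphism of $\mathbb{R}^{n+2}$ (acting on column vectors). $\rho_n$ is the involution $(h_0,\ldots,h_{n+1})\mapsto(h_{n+1},\ldots,h_1,h_0)$ of $\mathbb{R}^{n+2}$. *)

(* Defs.v *)
From mathcomp Require Import all_boot all_order all_algebra reals.

Set Implicit Arguments.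
Unset Strict Implicit.
Unset Printing Implicit Defensive.

Import GRing.Theory.

Section Complexes.
Variable V : finType.

(* A finite simplicial complex on the vertex type V is the set of its simplices,
   a simplex being the nonempty set of its vertices; it partitions the
   geometric realization into open simplices, so that removing a closed facet
   amounts to removing all the simplices contained in that facet. *)
Definition complex := {set {set V}}.

Definition closed_simplex (A : {set V}) : complex := powerset A :\ set0.

Definition facet (A : {set V}) (v : V) : {set V} := A :\ v.

(* The simplex A deprived of its closed facets opposite to the vertices in r. *)
Definition open_tile (A r : {set V}) : complex :=
  closed_simplex A :\: \bigcup_(v in r) closed_simplex (facet A v).

Definition is_chain (c : {set {set V}}) : bool :=
  [forall a in c, forall b in c, (a \subset b) || (b \subset a)].

End Complexes.

(* Barycentric subdivision: the vertices of Sd K are the simplices of K (seen as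
   their barycenters), and its simplices are the nonempty chains of simplices. *)
Definition Sd (V : finType) (K : complex V) : complex {set V} :=
  [set c : {set {set V}} | [&& c != set0, c \subset K & is_chain c]].

Section Tilings.
Variable n : nat.

Definition Delta : complex 'I_n.+1 := closed_simplex [set: 'I_n.+1].

(* Sd (T_s^n), the removed facets of the simplex with vertices 0, ..., n being
   those opposite to the vertices 0, ..., s - 1. *)
Definition SdT (s : nat) : complex {set 'I_n.+1} :=
  Sd Delta :\: \bigcup_(i : 'I_n.+1 | i < s) Sd (closed_simplex (facet setT i)).

(* B is an n-simplex c of Sd Delta deprived of t of its facets. *)
Definition is_tile (t : nat) (B : complex {set 'I_n.+1}) : bool :=
  [exists c in Sd Delta, exists r : {set {set 'I_n.+1}},
    [&& #|c| == n.+1, r \subset c, #|r| == t & B == open_tile c r]].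

Definition is_tiling (s : nat) (P : {set complex {set 'I_n.+1}}) : bool :=
  partition P (SdT s) && [forall B in P, exists t : 'I_n.+2, is_tile t B].

Definition hvec (P : {set complex {set 'I_n.+1}}) (t : 'I_n.+2) : nat :=
  #|[set B in P | is_tile t B]|.

(* H is the matrix H_n: each row s is the h-vector of a tiling of Sd (T_s^n)
   having exactly one tile T_0^n if s = 0 and none if s > 0. *)
Definition is_h_matrix (R : realType) (H : 'M[R]_n.+2) : Prop :=
  forall s : 'I_n.+2, exists P : {set complex {set 'I_n.+1}},
    [/\ is_tiling s P,
        hvec P ord0 = (if s == ord0 then 1%N else 0%N)
      & forall t : 'I_n.+2, H s t = (hvec P t)%:R%R].

End Tilings.

Definition rho (R : realType) (n : nat) (v : 'cV[R]_n.+2) : 'cV[R]_n.+2 :=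
  \col_i v (rev_ord i) ord0.

Definition mx_endo (R : realType) (n : nat) (H : 'M[R]_n.+2) :
  'End('cV[R]_n.+2) := linfun (mulmx H).

(* Main.v *)
From HB Require Import structures.
Require Import Defs.
From mathcomp Require Import all_boot all_order all_algebra reals ring zify.

(** Put [N = n + 1]. The faces of a tile of type [t], sorted by cardinal, have
    generating polynomial [X^t * (1 + X)^(N - t)], if the empty face is counted when
    [t = 0]. Let [F] be the unitriangular matrix
    of the coefficients of these polynomials ([face_mx]). A simplex of the barycentric
    subdivision is a chain of nonempty sets of vertices; it remains after the removal
    of [s] facets exactly when its top contains [s] given vertices, and a given
    [j]-set is the top of [S j k] chains of [k] sets, where [S] ([chain_mx]) counts the
    ordered partitions of a [j]-set into [k] blocks. Counting the faces of the
    subdivision in these two ways gives [H F = F S] ([h_matrix_face]), so that [H] is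
    uniquely determined and similar to [S]. Now [S] is lower triangular with
    diagonal entries [j!], which gives the characteristic polynomial; the only multiple
    eigenvalue is [1], and as the first two rows of [S] are those of the identity, the
    root [1] is simple in the minimal polynomial ([nonunit_eigen_poly_annihilate]).

    For the symmetry, the substitution [X |-> -1 - X] exchanges
    [X^t * (1 + X)^(N - t)] and [X^(N - t) * (1 + X)^t] up to the sign [(-1)^N].
    Conjugation by [F] therefore turns [rho] into the lower triangular matrix [K]
    ([reflection_mx]) of [p |-> (-1)^N p(-1 - X)], with diagonal entries
    [(-1)^(N - j)]. That [K] and [S] commute ([reflection_chain_comm]) says that the
    operator [T] sending [X^j] to the polynomial [P_j] of the row of index [j] of [S]
    commutes with this substitution. Removing the top of a chain gives
    [P_j = X * sum_(i < j) 'C(j, i) P_i] for [j > 0], that is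
    [(1 + X) T(p) = p(0) + X T(p(X + 1))]; this relation determines [T], and it is
    invariant under conjugation by the substitution ([umbral_reflection]).

    Finally, an eigenvector of [S] for a simple eigenvalue [s!] starts at the
    coordinate [s], and [K] acts on it by its diagonal entry [(-1)^(N - s)]
    ([trig_comm_eigen]). On the eigenspace of [1], which the first two coordinates
    parametrize, [K] acts with the opposite eigenvalues [(-1)^N] and [(-1)^n]
    ([chain_fixed_basis]). *)

Set Implicit Arguments.
Unset Strict Implicit.
Unset Printing Implicit Defensive.

Import GRing.Theory.
Local Open Scope ring_scope.

(** * Counting chains of sets by their top element *)

Section Counting.
Local Open Scope nat_scope.
Variable T : finType.
Implicit Types (A B r c a : {set T}) (k : nat).

(** Complementation in [c] turns the sets between [r] and [c] into the subsets of
    [c :\: r]. Choosing the complements rather than the sets themselves puts the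
    cardinals in a binomial coefficient that vanishes by itself when [k < #|r|]. *)
Lemma card_set_interval r c k : r \subset c -> k <= #|c| ->
  #|[set a : {set T} | [&& r \subset a, a \subset c & #|a| == k]]|
    = 'C(#|c| - #|r|, #|c| - k).
Proof.
move=> rc kc; rewrite -[in #|r|](setIidPr rc) -cardsD -cards_draws.
rewrite -[LHS](@card_in_imset _ _ (setD c)) => [|a b]; last first.
  rewrite !inE => /and3P[_ ac _] /and3P[_ bc _] /(congr1 (setD c)).
  by rewrite !setDDr !setDv !set0U (setIidPr ac) (setIidPr bc).
apply: eq_card => b; rewrite inE; apply/imsetP/andP => [[a]|[bc bk]].
  rewrite inE => /and3P[ra ac /eqP ak] ->; split; first exact: setDS.
  by rewrite cardsD (setIidPr ac) ak.
have bc' : b \subset c by apply: subset_trans bc (subsetDl _ _).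
exists (c :\: b); last by rewrite setDDr setDv set0U (setIidPr bc').
rewrite inE subsetDl cardsD (setIidPr bc') (eqP bk) subKn // eqxx andbT /=.
rewrite subsetD rc /= disjoint_sym; move: bc; rewrite subsetD.
by case/andP=> _ ->.
Qed.

(** A chain has a largest element, which is then the union of its elements. This
    is what lets [cover c] stand for the top of [c], with the convention that the
    empty chain has top [set0]. *)
Lemma cover_chain_in (c : {set {set T}}) :
  is_chain c -> c != set0 -> cover c \in c.
Proof.
move=> /forall_inP chc /set0Pn[A0 A0c].
case: (arg_maxnP (fun A => #|A|) A0c) => A Ac Amax.
suff -> : cover c = A by [].
apply/eqP; rewrite eqEsubset (bigcup_sup A) // andbT.
apply/bigcupsP => B Bc; have /forall_inP/(_ _ Bc)/orP[AB|//] := chc _ Ac.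
by have /eqP-> : A == B by rewrite eqEcard AB; apply: Amax.
Qed.

Definition chains A k : {set {set {set T}}} :=
  [set c | [&& is_chain c, set0 \notin c, cover c == A & #|c| == k]].

Lemma is_chainP (c : {set {set T}}) :
  reflect {in c &, forall a b : {set T}, (a \subset b) || (b \subset a)} (is_chain c).
Proof.
apply: (iffP forall_inP) => [h a b ac bc | h a ac].
  by move/forall_inP: (h a ac); apply.
by apply/forall_inP => b bc; apply: h.
Qed.

Lemma chains0 A : #|chains A 0| = (A == set0).
Proof.
have -> : chains A 0 = [set c | (c == set0) && (A == set0)].
  apply/setP => c; rewrite !inE cards_eq0.
  have [->|] := eqVneq c set0; last by rewrite !andbF.
  rewrite /cover big_set0 inE /= andbT eq_sym.
  by have -> : is_chain (set0 : {set {set T}}) by apply/is_chainP => a b; rewrite inE.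
case: (A == set0); last first.
  by apply/eqP; rewrite cards_eq0; apply/eqP/setP => c; rewrite !inE andbF.
by apply/eqP/cards1P; exists set0; apply/setP => c; rewrite !inE andbT.
Qed.

Lemma chains_top A k (c : {set {set T}}) : c \in chains A k.+1 -> A \in c.
Proof.
rewrite inE => /and4P[chc _ /eqP <- ck].
by apply: cover_chain_in; rewrite // -card_gt0 (eqP ck).
Qed.

(** Removing the top [A] of a nonempty chain leaves a chain whose top is a proper
    subset of [A], and this is a bijection. *)
Lemma card_chains_rec A k :
  #|chains A k.+1| = \sum_(B : {set T} | B \proper A) #|chains B k|.
Proof.
rewrite -sum1_card.
rewrite (partition_big (fun c : {set {set T}} => cover (c :\ A))
           (fun B : {set T} => B \proper A)) /=.
  apply: eq_bigr => B pBA; rewrite sum1dep_card.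
  have ABneq (c : {set {set T}}) : cover c = B -> A \notin c.
    move=> cB; apply/negP => Ac; move: pBA; rewrite properE -cB.
    by rewrite (bigcup_sup A) // andbF.
  rewrite -(card_in_imset (f := fun c : {set {set T}} => A |: c) (D := chains B k));
    last first.
    move=> c d; rewrite !inE.
    move=> /and4P[_ _ /eqP/ABneq Ac _] /and4P[_ _ /eqP/ABneq Ad _].
    by move=> /(congr1 (fun x => x :\ A)); rewrite !setU1K.
  apply: eq_card => c; rewrite inE; apply/andP/imsetP => [[cA cB]|[d]].
    have Ac := chains_top cA; exists (c :\ A); last by rewrite setD1K.
    move: cA; rewrite !inE cB => /and4P[/is_chainP chc c0 _].
    rewrite (cardsD1 A) Ac add1n eqSS => ->; rewrite (negPf c0) !andbF /= andbT.
    by apply/is_chainP => a b /setD1P[_ ac] /setD1P[_ bc]; apply: chc.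
  rewrite inE => /and4P[/is_chainP chd d0 /eqP dB /eqP dk] ->.
  have Ad := ABneq _ dB; split; last by rewrite setU1K // dB.
  rewrite inE cardsU1 Ad dk eqxx !inE negb_or d0 andbT /cover.
  rewrite bigcup_setU big_set1 -/(cover d) dB (setUidPl (proper_sub pBA)) eqxx /=.
  rewrite !andbT.
  apply/andP; split.
    have sub a : a \in d -> a \subset A.
      move=> ad; apply: subset_trans (proper_sub pBA); rewrite -dB.
      exact: (bigcup_sup a).
    apply/is_chainP => a b /setU1P[->|ad] /setU1P[->|bd]; rewrite ?subxx //.
    - by rewrite sub ?orbT.
    - by rewrite sub.
    - exact: chd.
  by apply: contraTneq pBA => <-; rewrite properE sub0set andbF.
move=> c cA; have Ac := chains_top cA; move: cA; rewrite inE => /and4P[chc c0 /eqP cA _].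
have chc' : is_chain (c :\ A).
  by apply/is_chainP => a b /setD1P[_ ac] /setD1P[_ bc]; apply: (is_chainP _ chc).
rewrite properEneq; apply/andP; split; last first.
  by apply/bigcupsP => B /setD1P[_ Bc]; rewrite -cA; apply: (bigcup_sup B).
have [->|cA0] := eqVneq (c :\ A) set0.
  by rewrite /cover big_set0; apply: contraNneq c0 => ->.
by have /setD1P[] := cover_chain_in chc' cA0.
Qed.

Lemma sum_card_interval r c (f : nat -> nat) : r \subset c ->
  \sum_(A : {set T} | (r \subset A) && (A \subset c)) f #|A|
   = \sum_(j < #|c|.+1) 'C(#|c| - #|r|, #|c| - j) * f j.
Proof.
move=> rc; rewrite (partition_big (fun A => inord #|A| : 'I_#|c|.+1) xpredT) //=.
apply: eq_bigr => j _; have jc : j <= #|c| by rewrite -ltnS.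
rewrite -card_set_interval // -sum_nat_const; apply: eq_big => [A|A]; last first.
  by move=> /andP[/andP[_ Ac] /eqP <-]; rewrite inordK // ltnS subset_leq_card.
rewrite inE -andbA; case: (r \subset A) => //=; case Ac: (A \subset c) => //=.
by rewrite -val_eqE /= inordK // ltnS subset_leq_card.
Qed.

End Counting.

(** The number of chains of [k] nonempty sets with top a given [j]-set, that is of
    ordered partitions of a [j]-set into [k] blocks, or of surjections from a
    [j]-set onto a [k]-set. The recursion chooses the second largest set. *)
Fixpoint nb_chains (k j : nat) : nat :=
  if k is k'.+1 then (\sum_(i < j) 'C(j, i) * nb_chains k' i)%N else j == 0%N.

Lemma card_chains (T : finType) (A : {set T}) k : #|chains A k| = nb_chains k #|A|.
Proof.
elim: k A => [|k IH] A; first by rewrite chains0 /= cards_eq0.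
rewrite card_chains_rec /=.
have -> : (\sum_(B : {set T} | B \proper A) #|chains B k|)%N =
   (\sum_(B : {set T} | (set0 \subset B) && (B \subset A))
     if (#|B| < #|A|)%N then nb_chains k #|B| else 0%N)%N.
  rewrite -big_mkcondr; apply: eq_big => [B|B _]; last exact: IH.
  by rewrite sub0set properEcard.
pose f j := if (j < #|A|)%N then nb_chains k j else 0%N.
rewrite (sum_card_interval f (sub0set A)) /f.
rewrite big_ord_recr /= ltnn muln0 addn0; apply: eq_bigr => i _.
by rewrite ltn_ord cards0 subn0 bin_sub // ltnW.
Qed.

Lemma nb_chains_small k j : (j < k)%N -> nb_chains k j = 0%N.
Proof.
elim: k j => // k IH j jk /=; rewrite big1 // => i _.
by rewrite IH ?muln0 //; apply: leq_trans (ltn_ord i) _.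
Qed.

Lemma nb_chains_diag j : nb_chains j j = j`!.
Proof.
elim: j => // j IH; rewrite /= big_ord_recr /= big1 ?add0n => [|i _].
  by rewrite IH factS binSn.
by rewrite nb_chains_small ?muln0.
Qed.

(** * Faces of a tiling of the subdivided simplex *)

Section Tiling.
Local Open Scope nat_scope.

Lemma mem_open_tile (V : finType) (A r a : {set V}) : r \subset A ->
  (a \in open_tile A r) = [&& a != set0, r \subset a & a \subset A].
Proof.
move=> rA; rewrite !inE; case: (eqVneq a set0) => [->|a0]; rewrite ?andbF //=.
case aA: (a \subset A); rewrite ?andbF ?andbT //.
apply/negP/subsetP => [nin v vr|ra].
  apply: contraT => va; case: nin; apply/bigcupP; exists v => //.
  by rewrite !inE a0 /= /facet subsetD1 aA.
by case/bigcupP => v /ra va; rewrite !inE /facet subsetD1 va !andbF.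
Qed.

Variable n : nat.

Definition first_vertices (s : nat) : {set 'I_n.+1} := [set i : 'I_n.+1 | i < s].

Lemma card_first_vertices s : s <= n.+1 -> #|first_vertices s| = s.
Proof.
move=> sn; have wI : injective (widen_ord sn) by move=> i j [ij]; apply: val_inj.
rewrite -[RHS]card_ord -(card_imset predT wI); apply: eq_card => i.
rewrite inE; apply/idP/imsetP => [i_s|[j _ ->]]; last exact: (ltn_ord j).
by exists (Ordinal i_s) => //; apply: val_inj.
Qed.

(** A chain of faces lies in the closed facet opposite to [i] exactly when its
    largest face avoids [i]. *)
Lemma mem_SdT s (c : {set {set 'I_n.+1}}) :
  (c \in SdT n s) =
    [&& c != set0, is_chain c, set0 \notin c & first_vertices s \subset cover c].
Proof.
have SdE (K : complex 'I_n.+1) : (c \in Sd K) = [&& c != set0, c \subset K & is_chain c].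
  by rewrite inE.
rewrite in_setD SdE; have -> : (c \subset Delta n) = (set0 \notin c).
  apply/subsetP/idP => [h|h a ac]; first by apply/negP => /h; rewrite !inE eqxx.
  by rewrite !inE subsetT andbT; apply: contraNneq h => <-.
case: (eqVneq c set0) => [->|c0]; rewrite ?andbF //=.
case chc: (is_chain c); rewrite ?andbF ?andbT //=.
case c00: (set0 \in c); rewrite /= ?andbF ?andbT //.
apply/negP/subsetP => [nin v|sub].
  rewrite inE => vs; apply: contraT => va; case: nin; apply/bigcupP; exists v => //.
  rewrite SdE c0 chc andbT /=; apply/subsetP => a ac; rewrite !inE; apply/andP; split.
    by apply: contraTneq ac => ->; rewrite c00.
  rewrite subsetD1 subsetT; apply: contra va => va; by apply/bigcupP; exists a.
case/bigcupP => v vs; rewrite SdE => /and3P[_ /subsetP h _].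
have /bigcupP[a /h] : v \in cover c by apply: sub; rewrite inE.
by rewrite !inE /facet subsetD1 => /and3P[_ _ /negP].
Qed.

Lemma card_SdT s k : s <= n.+1 -> 0 < k ->
  #|[set c in SdT n s | #|c| == k]|
    = \sum_(j < n.+2) 'C(n.+1 - s, n.+1 - j) * nb_chains k j.
Proof.
move=> sn k0.
have := sum_card_interval (nb_chains k) (subsetT (first_vertices s)).
rewrite cardsT card_ord card_first_vertices // => <-; rewrite -sum1_card.
rewrite (partition_big (@cover _)
   (fun A : {set 'I_n.+1} => (first_vertices s \subset A) && (A \subset setT))); last first.
  by move=> c; rewrite inE mem_SdT subsetT andbT => /andP[/and4P[]].
apply: eq_bigr => A /andP[sA _]; rewrite sum1dep_card -card_chains.
apply: eq_card => c; rewrite [RHS]inE inE [X in X && _]inE mem_SdT.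
case: (eqVneq (cover c) A) => [->|]; rewrite ?andbF // sA !andbT.
case: (eqVneq #|c| k) => [ck|]; rewrite ?andbF // !andbT.
by rewrite -card_gt0 ck k0.
Qed.

(** The faces of a tile are the nonempty sets between the set of vertices opposite
    to its removed facets and the set of all its vertices. *)
Lemma card_is_tile t k (B : complex {set 'I_n.+1}) : is_tile t B -> 0 < k <= n.+1 ->
  #|[set c in B | #|c| == k]| = 'C(n.+1 - t, n.+1 - k).
Proof.
case/exists_inP => c _ /existsP[r /and4P[/eqP cn rc /eqP <- /eqP ->]] /andP[k0 kn].
have := @card_set_interval _ r c k rc; rewrite cn => /(_ kn) <-; apply: eq_card => a.
rewrite [RHS]inE inE mem_open_tile //.
case: (eqVneq #|a| k) => [ak|]; rewrite ?andbF // !andbT.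
by rewrite -card_gt0 ak k0.
Qed.

(** The number of codimension one faces of a tile determines its type; for
    [n = 0] these faces would be empty, and the single vertex is a tile of
    types [0] and [1]. *)
Lemma is_tile_inj t t' B : 0 < n -> t <= n.+1 -> t' <= n.+1 ->
  is_tile (n := n) t B -> is_tile t' B -> t = t'.
Proof.
move=> n0 tn tn' tB tB'; have n0n : 0 < n <= n.+1 by rewrite n0 leqnSn.
have := card_is_tile tB n0n; rewrite (card_is_tile tB' n0n) subSnn !bin1.
by move/(congr1 (subn n.+1)); rewrite !subKn.
Qed.

Lemma tiling_face_count s (P : {set complex {set 'I_n.+1}}) k : 0 < n ->
  is_tiling s P -> 0 < k <= n.+1 ->
  #|[set c in SdT n s | #|c| == k]|
    = \sum_(t < n.+2) hvec P t * 'C(n.+1 - t, n.+1 - k).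
Proof.
move=> n0 /andP[Ppart /forall_inP tileP] kn.
rewrite -sum1dep_card (set_partition_big_cond P Ppart) /=.
under eq_bigr do rewrite sum1dep_card.
rewrite [RHS](eq_bigr (fun t : 'I_n.+2 =>
  \sum_(B in P | is_tile t B) #|[set c in B | #|c| == k]|)).
  rewrite (exchange_big_dep (fun B => B \in P)) /=; last by move=> t B _ /andP[].
  apply: eq_bigr => B BP; have /existsP[t tB] := tileP _ BP.
  rewrite (bigD1 t) ?BP //= big1 ?addn0 // => t' /andP[tB'].
  by rewrite -val_eqE /= (is_tile_inj n0 _ _ tB' tB) ?eqxx // -ltnS.
move=> t _; rewrite /hvec -sum_nat_const; apply: eq_big => B; first by rewrite inE.
by rewrite inE => /andP[_ tB]; rewrite (card_is_tile tB).
Qed.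

End Tiling.

(** The row of index [s] lists the coefficients of [X^s * (1 + X)^(N - s)], which
    counts the faces of a tile of type [s] by cardinal, the empty face included
    when [s = 0]. *)
Definition face_mx (R : pzRingType) N : 'M[R]_N.+1 :=
  \matrix_(s, k) ('C(N - s, N - k))%:R.

Definition chain_mx (R : pzRingType) N : 'M[R]_N.+1 :=
  \matrix_(j, k) (nb_chains k j)%:R.

(** Both sides count the faces of the half-open subdivided simplex by cardinal: on
    the left tile by tile, on the right by the top of the corresponding chain. The
    column of index [0], which would count an empty face, is the normalization of
    the number of tiles of type [0]. *)
Lemma h_matrix_face (R : realType) n (H : 'M[R]_n.+2) : (0 < n)%N -> is_h_matrix H ->
  H *m face_mx R n.+1 = face_mx R n.+1 *m chain_mx R n.+1.
Proof.
move=> n0 HP; apply/matrixP => s k; rewrite !mxE.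
have [P [tP P0 HE]] := HP s.
transitivity ((\sum_(t < n.+2) hvec P t * 'C(n.+1 - t, n.+1 - k))%N%:R : R).
  by rewrite natr_sum; apply: eq_bigr => t _; rewrite HE mxE natrM.
transitivity ((\sum_(j < n.+2) 'C(n.+1 - s, n.+1 - j) * nb_chains k j)%N%:R : R);
  last first.
  by rewrite natr_sum; apply: eq_bigr => t _; rewrite !mxE natrM.
congr (_%:R); have [k0|k0] := posnP k; last first.
  by rewrite -(tiling_face_count n0 tP) ?k0 -1?ltnS ?ltn_ord // card_SdT // -ltnS.
rewrite [LHS]big_ord_recl [RHS]big_ord_recl P0 k0 /= !subn0 binn !muln1.
rewrite big1 => [|i _]; last by rewrite bin_small ?muln0 // subSS ltnS leq_subr.
rewrite big1 => [|i _]; last by rewrite muln0.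
rewrite !addn0 -val_eqE /=; case: (val s) => [|m]; first by rewrite subn0 binn.
by rewrite bin_small // subSS ltnS leq_subr.
Qed.

(** * The reflection symmetry of the chain polynomials *)

Section Umbral.
Variable R : comNzRingType.
Implicit Types p q : {poly R}.

Lemma poly_span_ind (Q : {poly R} -> Prop) :
  (forall j, Q 'X^j) -> (forall a p q, Q p -> Q q -> Q (a *: p + q)) ->
  forall p, Q p.
Proof.
move=> QX QD p.
have Q0 : Q 0 by rewrite -(addNr 1) -(scaleN1r 1); apply: (QD); apply: (QX 0).
rewrite -[p]coefK poly_def; elim/big_ind: _ => // [x y Qx Qy|i _].
  by rewrite -[x]scale1r; apply: QD.
by rewrite -[_ *: _]addr0; apply: QD.
Qed.

Definition chain_poly j : {poly R} := \poly_(k < j.+1) (nb_chains k j)%:R.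

Lemma coef_chain_poly j k : (chain_poly j)`_k = (nb_chains k j)%:R.
Proof.
by rewrite coef_poly; case: ltnP => // jk; rewrite nb_chains_small.
Qed.

(** The recursion on the second largest set, completed by the term [i = j] so that
    the sum becomes the binomial expansion of [(1 + X)^j]. *)
Lemma chain_poly_rec j :
  (1 + 'X) * chain_poly j
    = ((j == 0%N)%:R)%:P + 'X * \sum_(i < j.+1) chain_poly i *+ 'C(j, i).
Proof.
apply/polyP => k; rewrite mulrDl mul1r !coefD !coefXM !coefC coef_chain_poly.
case: k => [|k]; first by rewrite /= !addr0.
rewrite /= add0r coef_sum coef_chain_poly natr_sum big_ord_recr /= binn mulr1n.
rewrite coef_chain_poly; congr (_ + _); apply: eq_bigr => i _.
by rewrite coefMn coef_chain_poly natrM mulr_natl.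
Qed.

(** The linear operator sending [X^j] to [chain_poly j]. In characteristic zero, it
    sends the polynomial [X (X - 1) ... (X - k + 1) / k!] to [X^k]. *)
Definition umbral p : {poly R} := \sum_(i < size p) p`_i *: chain_poly i.

Lemma umbral_widen m p : (size p <= m)%N ->
  umbral p = \sum_(i < m) p`_i *: chain_poly i.
Proof.
move=> pm; rewrite /umbral (big_ord_widen _ (fun i => p`_i *: chain_poly i) pm).
rewrite big_mkcond /=.
by apply: eq_bigr => i _; case: ltnP => // ?; rewrite nth_default ?scale0r.
Qed.

Lemma umbral_is_linear : linear umbral.
Proof.
move=> a p q; pose m := maxn (size (a *: p + q)) (maxn (size p) (size q)).
rewrite !(@umbral_widen m) ?leq_max ?leqnn ?orbT // scaler_sumr -big_split /=.
by apply: eq_bigr => i _; rewrite coefD coefZ scalerDl scalerA.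
Qed.

HB.instance Definition _ :=
  GRing.isLinear.Build R {poly R} {poly R} _ umbral umbral_is_linear.

Lemma umbralXn j : umbral 'X^j = chain_poly j.
Proof.
rewrite /umbral size_polyXn big_ord_recr /= coefXn eqxx scale1r big1 ?add0r // => i _.
by rewrite coefXn ltn_eqF // scale0r.
Qed.

Lemma comp_Xn_1X j : 'X^j \Po (1 + 'X) = \sum_(i < j.+1) 'X^i *+ 'C(j, i) :> {poly R}.
Proof. by rewrite comp_Xn_poly exprDn; apply: eq_bigr => i _; rewrite expr1n mul1r. Qed.

Lemma umbral_rec p :
  (1 + 'X) * umbral p = p.[0]%:P + 'X * umbral (p \Po (1 + 'X)).
Proof.
elim/poly_span_ind: p => [j|a p q IHp IHq].
  rewrite comp_Xn_1X raddf_sum umbralXn chain_poly_rec hornerXn expr0n.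
  by congr (_ + _ * _); apply: eq_bigr => i _; rewrite raddfMn /= umbralXn.
rewrite !linearP /= mulrDr -scalerAr IHp IHq hornerD hornerZ polyCD polyCM.
rewrite -!mul_polyC; ring.
Qed.

(** On [X^j] the two sides of the relation differ by [D 'X^j] and multiples of values
    of [D] in lower degree, which vanish by induction. Hence [umbral_rec]
    characterizes [umbral] among linear operators. *)
Lemma umbral_rec_unique (D : {linear {poly R} -> {poly R}}) :
  (forall p, (1 + 'X) * D p = 'X * D (p \Po (1 + 'X))) -> forall p, D p = 0.
Proof.
move=> DE; elim/poly_span_ind => [j|a p q Dp Dq]; last first.
  by rewrite linearP /= Dp Dq scaler0 addr0.
elim/ltn_ind: j => j IH; have := DE 'X^j.
rewrite comp_Xn_1X raddf_sum big_ord_recr big1 => [|i _]; last first.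
  by rewrite raddfMn /= IH // mul0rn.
rewrite /= binn mulr1n add0r mulrDl mul1r => /(canRL (addrK _)).
by rewrite subrr.
Qed.

Let r : {poly R} := - 1 - 'X.

(** Conjugating [umbral] by the involution [X |-> -1 - X] exchanges the factors
    [1 + X] and [X] of its functional equation, up to sign, and the arguments [p] and
    [p(1 + X)]; the conjugate satisfies the same equation, hence is [umbral]. *)
Lemma umbral_reflection p : umbral (p \Po r) = umbral p \Po r.
Proof.
have rK q : (q \Po r) \Po r = q.
  rewrite -comp_polyA /r !rmorphB /= rmorphN rmorph1 /= comp_polyX.
  by rewrite opprB addrC subrK comp_polyXr.
suff h : forall q, (comp_poly r \o umbral \o comp_poly r \- umbral) q = 0.
  by move/eqP: (h p); rewrite subr_eq0 /= => /eqP <-; rewrite rK.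
apply: umbral_rec_unique => {}p /=.
rewrite !mulrBr umbral_rec.
have /(congr1 (comp_poly r)) := umbral_rec ((p \Po (1 + 'X)) \Po r).
rewrite !rmorphD !rmorphM /= !rmorphD /= !rmorph1 /= !comp_polyX comp_polyC.
have -> : ((p \Po (1 + 'X)) \Po r) \Po (1 + 'X) = p \Po r.
  rewrite -!comp_polyA; congr (_ \Po _).
  by rewrite /r !(rmorphD, rmorphN, rmorph1) /= ?comp_polyX; ring.
have -> : ((p \Po (1 + 'X)) \Po r).[0] = p.[0].
  by rewrite !horner_comp /r !hornerE /= addrN oppr0 addr0.
rewrite /r => /eqP; rewrite -subr_eq0 => /eqP e.
by apply/eqP; rewrite -subr_eq0 -[X in _ == X]e; apply/eqP; ring.
Qed.

End Umbral.

Section Reflection.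
Variable R : comUnitRingType.

(** The matrix of [p |-> (-1)^N p(-1 - X)] on row vectors of coefficients. *)
Definition reflection_mx N : 'M[R]_N.+1 :=
  \matrix_(j, k) ((-1) ^+ (N - j) * ('C(j, k))%:R).

Lemma sign_sub N j : (j <= N)%N -> (-1) ^+ (N - j) = (-1) ^+ N * (-1) ^+ j :> R.
Proof. by move=> jN; rewrite -signr_odd oddB // signr_addb !signr_odd. Qed.

Lemma sum_bin_widen N j (jN : (j <= N)%N) (V : nmodType) (f : nat -> V) :
  \sum_(i < j.+1) f i *+ 'C(j, i) = \sum_(i < N.+1) f i *+ 'C(j, i).
Proof.
rewrite (big_ord_widen N.+1 (fun i => f i *+ 'C(j, i))) // big_mkcond /=.
by apply: eq_bigr => i _; case: ltnP => // ji; rewrite bin_small.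
Qed.

Lemma coef_exp1X m k : ((1 + 'X) ^+ m : {poly R})`_k = ('C(m, k))%:R.
Proof.
rewrite -comp_Xn_poly comp_Xn_1X.
rewrite (eq_bigr (fun i : 'I_m.+1 => ('C(m, i))%:R *: 'X^i)) => [|i _]; last first.
  by rewrite scaler_nat.
rewrite -(poly_def m.+1 (fun i => ('C(m, i))%:R)) coef_poly.
by case: ltnP => // mk; rewrite bin_small.
Qed.

Lemma comp_Xn_reflection j :
  'X^j \Po (- 1 - 'X) = (-1) ^+ j *: (1 + 'X) ^+ j :> {poly R}.
Proof.
by rewrite !comp_Xn_poly -opprD [LHS]exprNn -mul_polyC polyC_exp polyCN polyC1.
Qed.

Lemma coef_comp_Xn_reflection j k :
  ('X^j \Po (- 1 - 'X) : {poly R})`_k = (-1) ^+ j * ('C(j, k))%:R.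
Proof. by rewrite comp_Xn_reflection coefZ coef_exp1X. Qed.

(** This is [umbral_reflection] on the monomials, coefficient by coefficient. *)
Lemma reflection_chain_comm N :
  reflection_mx N *m chain_mx R N = chain_mx R N *m reflection_mx N.
Proof.
apply/matrixP => j k; rewrite !mxE.
have jN : (j <= N)%N by rewrite -ltnS.
have := congr1 (fun p : {poly R} => (-1) ^+ N * p`_k) (umbral_reflection 'X^j).
rewrite comp_Xn_reflection -comp_Xn_poly comp_Xn_1X linearZ /=.
rewrite (raddf_sum (@umbral R)) /= umbralXn coefZ coef_sum mulrA -sign_sub //.
rewrite (eq_bigr (fun i : 'I_j.+1 => (nb_chains k i)%:R *+ 'C(j, i))) => [|i _];
  last first.
  by rewrite raddfMn /= umbralXn coefMn coef_chain_poly.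
rewrite (sum_bin_widen jN (fun i => (nb_chains k i)%:R)) mulr_sumr => e.
rewrite (eq_bigr (fun i : 'I_N.+1 =>
  (-1) ^+ (N - j) * ((nb_chains k i)%:R *+ 'C(j, i)))) => [|i _]; last first.
  by rewrite !mxE -mulrA mulr_natl.
rewrite {}e /chain_poly poly_def raddf_sum coef_sum mulr_sumr.
rewrite (big_ord_widen N.+1 (fun i => (-1) ^+ N *
  (((nb_chains i j)%:R *: 'X^i) \Po (-1 - 'X) : {poly R})`_k)) //.
rewrite big_mkcond; apply: eq_bigr => i _.
rewrite !mxE comp_polyZ coefZ coef_comp_Xn_reflection.
rewrite sign_sub -1?ltnS //.
case: ltnP => ij; first by ring.
by rewrite nb_chains_small ?mul0r.
Qed.

(** The substitution [X |-> -1 - X] exchanges the generating polynomials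
    [X^s * (1 + X)^(N - s)] and [X^(N - s) * (1 + X)^s], up to the sign [(-1)^N]. *)
Lemma face_reflection N (s k : 'I_N.+1) :
  (face_mx R N *m reflection_mx N) s k = face_mx R N (rev_ord s) k.
Proof.
have sN : (s <= N)%N by rewrite -ltnS.
have kN : (k <= N)%N by rewrite -ltnS.
rewrite !mxE /= subSS subKn //.
(* The sum is a coefficient of (1 + X)^s * ((1 + X) - 1)^(N - s), expanded by
   the binomial formula in its second factor. *)
have e : \sum_(m < N.+1) ((-1) ^+ m *+ 'C(N - s, m)) *: (1 + 'X) ^+ (N - m) =
   'X ^+ (N - s) * (1 + 'X) ^+ s :> {poly R}.
  transitivity (((1 + 'X) - 1) ^+ (N - s) * (1 + 'X) ^+ s : {poly R}); last first.
    by rewrite addrAC subrr add0r.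
  rewrite exprBn mulr_suml (big_ord_widen N.+1 (fun m =>
    (-1) ^+ m * (1 + 'X) ^+ (N - s - m) * 1 ^+ m *+ 'C(N - s, m) * (1 + 'X) ^+ s));
    last by rewrite ltnS leq_subr.
  rewrite [RHS]big_mkcond /=.
  apply: eq_bigr => m _; case: ltnP => mN; last first.
    by rewrite bin_small // mulr0n scale0r.
  rewrite -mul_polyC rmorphMn rmorphXn /= rmorphN1 expr1n mulr1.
  by rewrite !mulrnAl -mulrA -exprD; congr (_ * _ ^+ _ *+ _); lia.
have := congr1 (fun p : {poly R} => p`_k) e; rewrite coef_sum coefXnM coef_exp1X.
rewrite (reindex_inj rev_ord_inj) /= => e'.
transitivity (if (k < N - s)%N then 0 : R else ('C(s, k - (N - s)))%:R); last first.
  case: ltnP => ks; first by rewrite bin_small //; lia.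
  by congr (_%:R); rewrite -[RHS]bin_sub; first congr ('C(_, _)); lia.
rewrite -{}e'; apply: eq_bigr => m _; rewrite !mxE /= subSS subKn -1?ltnS //.
by rewrite coefZ coef_exp1X mulrA mulr_natl.
Qed.

Lemma face_mx_unit N : face_mx R N \in unitmx.
Proof.
rewrite unitmxE -det_tr det_trig; last first.
  apply/is_trig_mxP => i j ij; rewrite !mxE bin_small //.
  have := ltn_ord i; have := ltn_ord j; lia.
by rewrite big1 ?unitr1 // => i _; rewrite !mxE binn.
Qed.

(** Through [face_mx] the reflection becomes the reversal of the rows. *)
Lemma reflection_mxK N : reflection_mx N *m reflection_mx N = 1%:M.
Proof.
apply: (can_inj (mulKmx (face_mx_unit N))); rewrite mulmx1 mulmxA.
apply/matrixP => s k; rewrite -[s in RHS]rev_ordK -face_reflection [LHS]mxE [RHS]mxE.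
by apply: eq_bigr => j _; rewrite face_reflection.
Qed.

End Reflection.

(** * Eigenvectors of triangular matrices *)

Section Triangular.
Variables (R : fieldType) (n : nat).
Implicit Types (A B : 'M[R]_n) (u : 'cV[R]_n) (a : R).

(** Read from the top, a coordinate of an eigenvector is determined by the previous
    ones unless the diagonal entry there is the eigenvalue itself. *)
Lemma trig_eigen_coord0 A u a (i : 'I_n) : is_trig_mx A -> A *m u = a *: u ->
  (forall j : 'I_n, (j <= i)%N -> A j j = a -> u j 0 = 0) -> u i 0 = 0.
Proof.
move=> /is_trig_mxP At Au; have [m] := ubnP (val i).
elim: m => // m IH in i * => /ltnSE im h.
have [/h->//|Aii] := eqVneq (A i i) a.
have := congr1 (fun v : 'cV_n => v i 0) Au; rewrite !mxE (bigD1 i) //= big1 ?addr0.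
  move/eqP; rewrite -subr_eq0 -mulrBl mulf_eq0 subr_eq0 (negPf Aii) /=.
  by move/eqP.
move=> j ji; have [ij|{}ji'] := ltnP i j; first by rewrite At ?mul0r.
have lt_ji : (j < i)%N by rewrite ltn_neqAle ji' andbT.
rewrite IH ?mulr0 //; first exact: leq_trans lt_ji im.
by move=> k kj; apply: h; apply: leq_trans kj ji'.
Qed.

Lemma trig_mul_first A u (i : 'I_n) : is_trig_mx A ->
  (forall j : 'I_n, (j < i)%N -> u j 0 = 0) -> (A *m u) i 0 = A i i * u i 0.
Proof.
move=> /is_trig_mxP At u0; rewrite mxE (bigD1 i) //= big1 ?addr0 // => j ji.
have [ij|ji'] := ltnP i j; first by rewrite At ?mul0r.
by rewrite u0 ?mulr0 // ltn_neqAle ji' andbT.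
Qed.

(** The eigenline of a simple eigenvalue is stable under everything that commutes
    with [A]; comparing the first nonzero coordinates identifies the factor. *)
Lemma trig_comm_eigen A B u (i : 'I_n) : is_trig_mx A -> is_trig_mx B ->
  B *m A = A *m B -> (forall j, A j j = A i i -> j = i) ->
  A *m u = A i i *: u -> B *m u = B i i *: u.
Proof.
move=> At Bt AB Ai Au; apply/eqP; rewrite -subr_eq0; apply/eqP; set w := _ - _.
have Aw : A *m w = A i i *: w.
  rewrite mulmxBr mulmxA -AB -mulmxA -scalemxAr Au -scalemxAr scalerBr.
  by rewrite scalerA mulrC -scalerA.
have u0 (j : 'I_n) : (j < i)%N -> u j 0 = 0.
  move=> ji; apply: (trig_eigen_coord0 At Au) => k kj /Ai ki.
  by move: (leq_ltn_trans kj ji); rewrite ki ltnn.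
apply/colP => j; rewrite [RHS]mxE; apply: (trig_eigen_coord0 At Aw) => k _ /Ai ->.
by rewrite /w mxE (trig_mul_first Bt u0) !mxE subrr.
Qed.

End Triangular.

Lemma horner_mx_left_eigen (R : comNzRingType) n (A : 'M[R]_n.+1) (v : 'rV_n.+1) a p :
  v *m A = a *: v -> v *m horner_mx A p = p.[a] *: v.
Proof.
move=> vA; elim/poly_ind: p => [|p c IH]; first by rewrite rmorph0 mulmx0 horner0 scale0r.
rewrite rmorphD rmorphM /= horner_mx_X horner_mx_C mulmxDr mulmxA IH -scalemxAl vA.
by rewrite scalerA mul_mx_scalar -scalerDl hornerMXaddC.
Qed.

Lemma char_poly_sim (R : fieldType) n (A B P : 'M[R]_n) : P \in unitmx ->
  A *m P = P *m B -> char_poly A = char_poly B.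
Proof.
move=> Pu AP; rewrite /char_poly; pose Q := map_mx polyC P.
have /(congr1 (@determinant _ _)) : char_poly_mx A *m Q = Q *m char_poly_mx B.
  rewrite mulmxBl mulmxBr mul_scalar_mx mul_mx_scalar -!map_mxM /=.
  by rewrite AP.
rewrite !det_mulmx mulrC; apply: mulfI.
by rewrite det_map_mx polyC_eq0 -unitfE.
Qed.

Lemma horner_mx_sim0 (R : fieldType) n (A B P : 'M[R]_n.+1) p : P \in unitmx ->
  A *m P = P *m B -> horner_mx B p = 0 -> horner_mx A p = 0.
Proof.
move=> Pu AP pB; have -> : A = P *m B *m invmx P by rewrite -AP mulmxK.
by rewrite horner_mx_uconj // pB mulmx0 mul0mx.
Qed.

(** * Spectrum of the chain matrix *)

Section ChainMatrix.
Variables (R : numFieldType) (n : nat).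
Local Notation N := n.+1.
Local Notation S := (chain_mx R N).
Local Notation K := (reflection_mx R N).

Lemma chain_mx_trig : is_trig_mx S.
Proof. by apply/is_trig_mxP => i j ij; rewrite mxE nb_chains_small. Qed.

Lemma chain_mx_diag i : S i i = (i`!)%:R.
Proof. by rewrite mxE nb_chains_diag. Qed.

Lemma reflection_mx_trig : is_trig_mx K.
Proof. by apply/is_trig_mxP => i j ij; rewrite mxE bin_small ?mulr0. Qed.

Lemma reflection_mx_diag i : K i i = (-1) ^+ (N - i).
Proof. by rewrite mxE binn mulr1. Qed.

(** For [s >= 2] the number [s!] appears only once on the diagonal. *)
Lemma chain_eigen_reflection s (u : 'cV[R]_N.+1) : (2 <= s <= N)%N ->
  S *m u = (s`!)%:R *: u -> K *m u = (-1) ^+ (N - s) *: u.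
Proof.
move=> /andP[s2 sN]; have sN1 : (s < N.+1)%N by [].
have := @trig_comm_eigen _ _ _ _ u (Ordinal sN1) chain_mx_trig reflection_mx_trig.
rewrite reflection_chain_comm chain_mx_diag reflection_mx_diag; apply=> // j.
rewrite chain_mx_diag => /eqP; rewrite Num.Theory.eqr_nat => /eqP js.
apply: val_inj => /=.
have [lt_js|lt_sj|//] := ltngtP (val j) s.
  case: (posnP j) => [j0|j0]; last by have := ltn_fact j0 lt_js; rewrite js ltnn.
  by move: js (ltn_fact (ltn0Sn 0) s2); rewrite j0 /= => <-.
by have := ltn_fact (ltnW s2) lt_sj; rewrite js ltnn.
Qed.

Let i0 : 'I_N.+1 := ord0.
Let i1 : 'I_N.+1 := lift ord0 ord0.

(** Only the first two diagonal entries of the chain matrix are equal to [1], so that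
    the corresponding coordinates determine a fixed vector. *)
Lemma chain_fixed_eq0 (u : 'cV[R]_N.+1) :
  S *m u = u -> u i0 0 = 0 -> u i1 0 = 0 -> u = 0.
Proof.
move=> Su u0 u1; rewrite -[RHS]/(0 : 'cV_ _); apply/colP => i; rewrite [RHS]mxE.
apply: (@trig_eigen_coord0 _ _ S _ 1 _ chain_mx_trig); first by rewrite scale1r.
move=> j _; rewrite chain_mx_diag => /eqP.
rewrite (Num.Theory.eqr_nat R _ 1) => /eqP j1.
have [j2|j2] := ltnP 1 j; first by have := ltn_fact (ltn0Sn 0) j2; rewrite j1.
suff [->|->] : j = i0 \/ j = i1 by [].
move: j2; case: (posnP j) => j0 j2; [left | right]; apply: val_inj => //=.
by rewrite /bump /=; lia.
Qed.

(** The factor of the characteristic polynomial of [chain_mx] that collects the roots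
    other than [1]. *)
Definition nonunit_eigen_poly : {poly R} := \prod_(i < n) ('X - ((i.+2)`!%:R)%:P).

Lemma char_poly_chain : char_poly S = ('X - 1) * (('X - 1) * nonunit_eigen_poly).
Proof.
rewrite (char_poly_trig chain_mx_trig) !big_ord_recl !chain_mx_diag.
by congr (_ * (_ * _)); apply: eq_bigr => i _; rewrite chain_mx_diag.
Qed.

(** The first two rows of the chain matrix are those of the identity: the first two
    unit row vectors are fixed, so that a polynomial acts on them by its value at
    [1]. *)
Lemma chain_row01 p (i j : 'I_N.+1) : (i <= 1)%N ->
  horner_mx S p i j = p.[1] *+ (i == j).
Proof.
move=> i1'; pose v : 'rV[R]_N.+1 := delta_mx 0 i.
have vS : v *m S = 1 *: v.
  rewrite scale1r -rowE; apply/rowP => k; rewrite !mxE eqxx /=.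
  have [->|ik] := eqVneq k i; first by rewrite nb_chains_diag; case: (val i) i1' => [|[]].
  case: (ltngtP i k) => [ik'|ki|/val_inj ki]; last by rewrite ki eqxx in ik.
    by rewrite nb_chains_small.
  have k0 : k = 0 :> nat by lia.
  by rewrite k0 /=; case: (val i) ki.
have := horner_mx_left_eigen p vS; rewrite -rowE => /rowP/(_ j).
by rewrite !mxE eqxx /= eq_sym => ->; rewrite mulr_natr.
Qed.

(** By Cayley-Hamilton, multiplying by [S - 1] once more gives [0], so that the
    columns of this matrix are fixed by [S]; their first two coordinates vanish. The
    double root [1] of the characteristic polynomial is thus simple in the minimal
    polynomial. *)
Lemma nonunit_eigen_poly_annihilate : horner_mx S (('X - 1) * nonunit_eigen_poly) = 0.
Proof.
set p := _ * _; set Q := horner_mx S p.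
have SQ : S *m Q = Q.
  have := Cayley_Hamilton S; rewrite char_poly_chain -/p rmorphM rmorphB /=.
  by rewrite horner_mx_X rmorph1 mulrBl mul1r => /eqP; rewrite subr_eq0 => /eqP.
have p1 : p.[1] = 0 by rewrite hornerM !hornerE subrr mul0r.
apply/matrixP => i j; have -> : Q i j = col j Q i 0 by rewrite mxE.
rewrite (@chain_fixed_eq0 (col j Q)) ?mxE //; first by rewrite !colE mulmxA SQ.
  by rewrite chain_row01 // p1 mul0rn.
by rewrite chain_row01 // p1 mul0rn.
Qed.

Let c : R := nonunit_eigen_poly.[1].

Lemma nonunit_eigen_poly1_neq0 : c != 0.
Proof.
rewrite /c horner_prod; apply/prodf_neq0 => i _; rewrite !hornerE subr_eq0.
rewrite (Num.Theory.eqr_nat R 1); apply/eqP => e.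
by have := @ltn_fact 1 i.+2 isT isT; rewrite -e.
Qed.

(** The first two columns of [horner_mx S nonunit_eigen_poly] are fixed by [S], and
    their first two coordinates are those of a multiple of the identity. The second
    one is an eigenvector of the reflection by triangularity; the first one has to be
    projected on the eigenspace of the involution for [(-1)^N]. *)
Lemma chain_fixed_basis :
  exists w1 w2 : 'cV[R]_N.+1,
  [/\ S *m w1 = w1 /\ S *m w2 = w2, w1 != 0 /\ w2 != 0,
      K *m w1 = (-1) ^+ N *: w1, K *m w2 = (-1) ^+ n *: w2
    & forall u, S *m u = u -> exists a b, u = a *: w1 + b *: w2].
Proof.
pose Q := horner_mx S nonunit_eigen_poly.
have SQ : S *m Q = Q.
  have := nonunit_eigen_poly_annihilate; rewrite rmorphM rmorphB /=.
  by rewrite horner_mx_X rmorph1 mulrBl mul1r => /eqP; rewrite subr_eq0 => /eqP.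
pose w j := col j Q.
have Sw j : S *m w j = w j by rewrite /w !colE mulmxA SQ.
have w0E j : w j i0 0 = c *+ (i0 == j) by rewrite mxE chain_row01.
have w1E j : w j i1 0 = c *+ (i1 == j) by rewrite mxE chain_row01.
have SK u : S *m u = u -> S *m (K *m u) = K *m u.
  by move=> Su; rewrite mulmxA -reflection_chain_comm -mulmxA Su.
have c0 := nonunit_eigen_poly1_neq0.
pose w1 := w i0 + (-1) ^+ N *: (K *m w i0); pose w2 := w i1.
have Sw1 : S *m w1 = w1 by rewrite mulmxDr -scalemxAr SK ?Sw.
have w1_0 : w1 i0 0 = c *+ 2.
  rewrite /w1 mxE [X in _ + X]mxE (trig_mul_first reflection_mx_trig) // w0E eqxx.
  by rewrite reflection_mx_diag subn0 mulrA -expr2 sqrr_sign mul1r.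
have w2_0 : w2 i0 0 = 0 by rewrite w0E.
have w2_1 : w2 i1 0 = c by rewrite w1E eqxx.
have c20 : c *+ 2 != 0 by rewrite Num.Theory.mulrn_eq0.
exists w1, w2; split.
- by split; last exact: Sw.
- split; first by apply: contraNneq c20 => w10; rewrite -w1_0 w10 mxE.
  by apply: contraNneq c0 => w20; rewrite -w2_1 w20 mxE.
- rewrite /w1 mulmxDr -scalemxAr mulmxA reflection_mxK mul1mx scalerDr scalerA.
  by rewrite -expr2 sqrr_sign scale1r addrC.
- apply/eqP; rewrite -subr_eq0; apply/eqP; apply: chain_fixed_eq0.
  + by rewrite mulmxBr -scalemxAr SK Sw.
  + rewrite mxE (trig_mul_first reflection_mx_trig) // !mxE.
    by rewrite -[Q i0 i1]/(horner_mx S _ i0 i1) chain_row01 // mulr0n !mulr0 subrr.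
  + rewrite mxE (trig_mul_first reflection_mx_trig) => [|j].
      by rewrite reflection_mx_diag subSS subn0 !mxE subrr.
    by rewrite /i1 ltnS leqn0 => /eqP j0; rewrite (_ : j = i0) //; apply: val_inj.
- have Sw2 : S *m w2 = w2 := Sw i1.
  clearbody w1 w2; move=> u Su.
  pose a := u i0 0 / (c *+ 2); pose b := (u i1 0 - a * w1 i1 0) / c.
  exists a, b; apply/eqP; rewrite -subr_eq0; apply/eqP; apply: chain_fixed_eq0.
  + by rewrite mulmxBr mulmxDr -!scalemxAr Su Sw1 Sw2.
  + by rewrite !mxE w2_0 w1_0 mulr0 addr0 divfK // subrr.
  + by rewrite !mxE w2_1 divfK // [_ * _ + _]addrC subrK subrr.
Qed.

End ChainMatrix.

(** * Transfer to the matrix of h-vectors *)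

Lemma rho_face (R : realType) n (v : 'cV[R]_n.+2) :
  rho (face_mx R n.+1 *m v) = face_mx R n.+1 *m (reflection_mx R n.+1 *m v).
Proof.
apply/colP => i; rewrite mulmxA !mxE; apply: eq_bigr => j _.
by rewrite face_reflection.
Qed.

Lemma mem_leigenspace (R : realType) n (H : 'M[R]_n.+2) a (v : 'cV[R]_n.+2) :
  (v \in passmx.leigenspace (mx_endo H) a) = (H *m v == a *: v).
Proof.
by rewrite memv_ker add_lfunE opp_lfunE scale_lfunE id_lfunE lfunE subr_eq0.
Qed.

Lemma rhoZ (R : realType) n a (v : 'cV[R]_n.+2) : rho (a *: v) = a *: rho v.
Proof. by apply/colP => i; rewrite !mxE. Qed.

Theorem theorem1p10 (R : realType) (n : nat) (H : 'M[R]_n.+2)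
    (n_gt0 : (0 < n)%N) (HP : is_h_matrix H) :
  [/\ diagonalizable H
      /\ char_poly H = \prod_(s < n.+2) ('X - ((s`!)%:R)%:P),
      forall v : 'cV[R]_n.+2, H *m rho v = rho (H *m v),
      forall s : nat, (2 <= s <= n.+1)%N ->
        forall v : 'cV[R]_n.+2, v \in passmx.leigenspace (mx_endo H) (s`!)%:R ->
          rho v = (-1) ^+ (n.+1 - s) *: v
    & \dim (passmx.leigenspace (mx_endo H) 1) = 2%N
      /\ exists L1 L2 : {vspace 'cV[R]_n.+2},
        [/\ \dim L1 = 1%N /\ \dim L2 = 1%N,
            directv (L1 + L2) /\ (L1 + L2)%VS = passmx.leigenspace (mx_endo H) 1,
            forall v, v \in L1 -> rho v = (-1) ^+ n.+1 *: v
          & forall v, v \in L2 -> rho v = (-1) ^+ n *: v]].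
Proof.
pose F := face_mx R n.+1; pose S := chain_mx R n.+1; pose K := reflection_mx R n.+1.
have Fu : F \in unitmx := face_mx_unit R n.+1.
have HF : H *m F = F *m S := h_matrix_face n_gt0 HP.
have Finj : injective (mulmx F : 'cV_n.+2 -> 'cV_n.+2) := can_inj (mulKmx Fu).
have eigenE a (v : 'cV_n.+2) : H *m (F *m v) = a *: (F *m v) <-> S *m v = a *: v.
  rewrite mulmxA HF -mulmxA scalemxAr; split=> [e|-> //]; exact: Finj.
have Fsurj (v : 'cV_n.+2) : exists w, v = F *m w by exists (invmx F *m v); rewrite mulKVmx.
split.
- split.
    apply/diagonalizableP; exists (1 :: [seq (i.+2)`!%:R | i <- index_iota 0 n]).
      rewrite /= map_inj_in_uniq ?iota_uniq ?andbT.
        apply/mapP => -[i _ /eqP]; rewrite (Num.Theory.eqr_nat R 1) => /eqP e.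
        by have := @ltn_fact 1 i.+2 isT isT; rewrite -e.
      move=> i j _ _ /eqP; rewrite Num.Theory.eqr_nat => /eqP e.
      apply/eqP; rewrite eqn_leq.
      by apply/andP; split; rewrite leqNgt; apply/negP => lt_ij;
        have := @ltn_fact _ _ (ltn0Sn _) (lt_ij : (_.+2 < _.+2)%N); rewrite e ltnn.
    rewrite big_cons big_map big_mkord; apply: mxminpoly_min.
    exact: horner_mx_sim0 Fu HF (nonunit_eigen_poly_annihilate R n).
  rewrite (char_poly_sim Fu HF) (char_poly_trig (chain_mx_trig R n)).
  by apply: eq_bigr => i _; rewrite chain_mx_diag.
- move=> v; have [w ->] := Fsurj v.
  rewrite rho_face !mulmxA HF -[F *m S *m K]mulmxA -reflection_chain_comm.
  by rewrite -[F *m S *m w]mulmxA rho_face !mulmxA.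
- move=> s s_bd v; rewrite mem_leigenspace; have [w ->] := Fsurj v.
  move=> /eqP/eigenE/(chain_eigen_reflection s_bd) Kw.
  by rewrite rho_face Kw -scalemxAr.
have [w1 [w2 [[Sw1 Sw2] [w10 w20] Kw1 Kw2 span12]]] := chain_fixed_basis R n.
pose L1 := <[F *m w1]>%VS; pose L2 := <[F *m w2]>%VS.
have Fneq0 (w : 'cV_n.+2) : w != 0 -> F *m w != 0.
  by apply: contra_neq => Fw; apply: Finj; rewrite mulmx0.
have d1 : \dim L1 = 1%N by rewrite dim_vline Fneq0.
have d2 : \dim L2 = 1%N by rewrite dim_vline Fneq0.
have rho1 v : v \in L1 -> rho v = (-1) ^+ n.+1 *: v.
  by move=> /vlineP[a ->]; rewrite rhoZ rho_face Kw1 -scalemxAr !scalerA mulrC.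
have rho2 v : v \in L2 -> rho v = (-1) ^+ n *: v.
  by move=> /vlineP[a ->]; rewrite rhoZ rho_face Kw2 -scalemxAr !scalerA mulrC.
have dir : directv (L1 + L2).
  apply/directv_addP/eqP; rewrite -subv0; apply/subvP => v; rewrite memv_cap memv0.
  move=> /andP[/rho1 r1 /rho2]; rewrite r1 exprS mulN1r scaleNr => /eqP.
  rewrite eq_sym -addr_eq0 -mulr2n -scaler_nat scalerA scaler_eq0 mulf_eq0.
  by rewrite signr_eq0 Num.Theory.pnatr_eq0.
have sumE : (L1 + L2)%VS = passmx.leigenspace (mx_endo H) 1.
  apply/eqP; rewrite eqEsubv; apply/andP; split; apply/subvP => v.
    move=> /memv_addP[_ /vlineP[a ->] [_ /vlineP[b ->] ->]].
    rewrite mem_leigenspace scale1r mulmxDr -!scalemxAr !mulmxA HF -!mulmxA.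
    by rewrite Sw1 Sw2.
  rewrite mem_leigenspace; have [w ->] := Fsurj v.
  move=> /eqP/eigenE; rewrite scale1r => /span12[a [b ->]].
  by rewrite mulmxDr -!scalemxAr memv_add ?memvZ ?memv_line.
split; last by exists L1, L2.
rewrite -sumE dimv_disjoint_sum ?d1 ?d2 //; exact/directv_addP.
Qed.
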